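(* Let $\{P_\varepsilon\}$, indexed by the infinite binary sequences $\varepsilon=(\varepsilon_N)_{N\ge 5}\in\{0,1\}^{\{5,6,7,\dots\}}$, be the crown/reflection family of locally finite $1$-differential posets (defined in the context). Then the set of quotient series $$\left\{Q_{P_\varepsilon}(q)\;:\;\varepsilon\in\{0,1\}^{\{5,6,7,\dots\}}\right\}\subset\mathbb{Z}[[q]]$$ has the cardinality of the continuum, and continuum many of its members are not rational over any field of characteristic zero.
   Context: Posets $P=\bigsqcup_{n\ge0}P_n$ are graded with rank function $\rho$ and least element $\widehat 0$; $x\lessdot y$ means $y$ covers $x$; elements covered by $x$ are its lower covers and elements covering $x$ its upper covers. $P$ is $1$-differential if (D1) it is locally finite and graded with least element $\widehat 0$; (D2) any two distinct elements have as many common upper covers as common lower covers; (D3) an element with $d$ lower covers has $d+1$ upper covers. A finite graded poset with least element $\widehat 0$ and ranks $0,\dots,n$ is a $1$-differential prefix through rank $n$ if (D2) and (D3) hold for elements of rank less than $n$. Ordinary reflection extension. Given a $1$-differential prefix through rank $n$, for $y\in P_{n-1}$ let $B_y=\{x\in P_n: y\lessdot x\}$. The new rank $P_{n+1}$ has one element for each $y\in P_{n-1}$, with lower-cover set $B_y$, and one element for each $x\in P_n$, with lower-cover set $\{x\}$ (counted with multiplicity; for $n=0$ there are no sets $B_y$). Crown extension at $y$. Suppose $y\in P_{n-1}$ has exactly two lower covers, so that by (D3) $B_y=\{a,b,c\}$ has three elements. Form the ordinary reflection extension but replace the four new elements with lower-cover sets $\{a,b,c\}$ (the one attached to $y$),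 $\{a\}$, $\{b\}$, $\{c\}$ (the ones attached to $a,b,c$) by three new elements with lower-cover sets $\{a,b\},\{a,c\},\{b,c\}$, leaving all other new elements unchanged. Both extensions are $1$-differential prefixes through rank $n+1$. Crown/reflection family. Start with the prefix through rank $4$ obtained from the one-point poset $P_0=\{\widehat 0\}$ by four successive ordinary reflection extensions; its rank sizes are $1,1,2,3,5$. Fix labels $a_2,b_2$ for the two elements of rank $2$. In any $1$-differential prefix extending ranks $0,1,2$, one defines inductively for $i\ge 2$ (as long as rank $i+1$ is present): $b_{i+1}$ is the unique common upper cover of $a_i$ and $b_i$, and $a_{i+1}$ is the other upper cover of $a_i$ (which has exactly two upper covers); then $a_{i+1}$ has lower-cover set $\{a_i\}$ and $b_{i+1}$ has lower-cover set $\{a_i,b_i\}$. Given $\varepsilon$, for each $N=5,6,7,\dots$ in turn, extend the prefix through rank $N-1$ to rank $N$ by the ordinary reflection extension if $\varepsilon_N=0$, and by the crown extension at the distinguished element $b_{N-2}\in P_{N-2}$ (which has exactly two lower covers and three upper covers) if $\varepsilon_N=1$. The poset $P_\varepsilon$ is the union of these prefixes; it is a locally finite $1$-differential poset. For such a poset $P$, with $p_n=|P_n|$ (finite), put $F_P(q)=\sum_{n\ge0}p_nq^n$, $M_{P,2}(q)=\sum_{\widehat 0\le x_1\le x_2}q^{\rho(x_1)+\rho(x_2)}$ (sum over pairs of elements $x_1\le x_2$ of $P$), and $Q_P(q)=M_{P,2}(q)/F_P(q)^2\in\mathbb{Z}[[q]]$. A series $S(q)\in\mathbb{Q}[[q]]$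 is rational over a field $K$ of characteristic zero if, viewed in $K[[q]]$, there are $A,B\in K[q]$ with $B\ne0$ and $B(q)S(q)=A(q)$. *)

(* Defs.v *)
From mathcomp Require Import all_boot all_order all_algebra.
From Stdlib Require Import Relation_Operators.

Set Implicit Arguments.
Unset Strict Implicit.
Unset Printing Implicit Defensive.

(* A graded poset with finite ranks, given by its Hasse diagram: every cover
   relation joins two consecutive ranks. *)
Record hasse := Hasse {
  rank_elt : nat -> finType;
  cov : forall n, rank_elt n -> rank_elt n.+1 -> bool
}.

Definition elt (P : hasse) : Type := {n : nat & rank_elt P n}.

Inductive covered (P : hasse) : elt P -> elt P -> Prop :=
  Covered n (x : rank_elt P n) (y : rank_elt P n.+1) of cov x y :
    covered (existT _ n x) (existT _ n.+1 y).

Definition hle (P : hasse) : elt P -> elt P -> Prop :=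
  clos_refl_trans (elt P) (@covered P).

Definition upper_covers (P : hasse) n (x : rank_elt P n) :
  {set rank_elt P n.+1} := [set y | cov x y].

Definition lower_covers (P : hasse) n :
    rank_elt P n -> {set rank_elt P n.-1} :=
  match n with
  | 0 => fun=> set0
  | m.+1 => fun x => [set y | cov y x]
  end.

(* Since the ranks are finite, (D1) amounts to the first two items.  Elements of
   different ranks have no common upper or lower cover, so (D2) is a condition
   on pairs of elements of the same rank. *)
Definition differential1 (P : hasse) : Prop :=
  [/\ #|rank_elt P 0| = 1,
      forall n (x : rank_elt P n.+1), lower_covers x != set0,
      forall n (x y : rank_elt P n), x != y ->
        #|upper_covers x :&: upper_covers y|
          = #|lower_covers x :&: lower_covers y|
    & forall n (x : rank_elt P n),
        #|upper_covers x| = #|lower_covers x|.+1].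

(* The two highest ranks of a prefix, which is all that an extension depends on.
   For a prefix consisting of rank 0 only, [prev] is empty. *)
Record frontier := Frontier {
  prev : finType;
  cur : finType;
  low : cur -> {set prev}
}.

Definition up (s : frontier) (y : prev s) : {set cur s} := [set x | y \in low x].

(* The elements of the new rank: [inl y] is attached to [y : kept] and [inr x]
   to [x : cur s]. *)
Record extension (s : frontier) := Extension {
  kept : finType;
  newlow : kept + cur s -> {set cur s}
}.

Definition reflection (s : frontier) : extension s :=
  @Extension s (prev s) (fun u => match u with
                                  | inl y => up y
                                  | inr x => [set x]
                                  end).

(* The element attached to [y] is deleted, and when [up y] is {a, b, c} the
   elements attached to a, b, c get the lower-cover sets {b, c}, {a, c}, {a, b}
   in place of {a}, {b}, {c}. *)
Definition crown (s : frontier) (y : prev s) : extension s :=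
  @Extension s {z : prev s | z != y}
    (fun u => match u with
              | inl z => up (val z)
              | inr x => if x \in up y then up y :\ x else [set x]
              end).

Definition extend (s : frontier) (E : extension s) : frontier :=
  @Frontier (cur s) (kept E + cur s)%type (@newlow s E).

Definition front0 : frontier := @Frontier void unit (fun=> set0).
Definition front1 : frontier := extend (reflection front0).
Definition front2 : frontier := extend (reflection front1).

Definition rank2 : finType := cur front2.

(* A prefix through rank n >= 3 with the distinguished elements b_{n-1}, a_n
   and b_n. *)
Record labelled := Labelled {
  front :> frontier;
  lab_b' : prev front;
  lab_a : cur front;
  lab_b : cur front
}.

(* The labels are transported from [s], where they are [a] and [b], to the
   extension.  The default values of [odflt] are irrelevant: by
   [labels_correct] the labels obtained are the intended ones. *)
Definition next_b (s : frontier) (E : extension s) (a b : cur s) :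
    cur (extend E) :=
  odflt (inr b) [pick x : cur (extend E) | (a \in low x) && (b \in low x)].

Definition next_a (s : frontier) (E : extension s) (a b : cur s) :
    cur (extend E) :=
  odflt (inr a)
    [pick x : cur (extend E) | (a \in low x) && (x != next_b E a b)].

Definition advance (s : frontier) (E : extension s) (a b : cur s) : labelled :=
  @Labelled (extend E) b (next_a E a b) (next_b E a b).

(* The sequence (eps_N)_(N >= 5) is encoded as e : nat -> bool with
   eps_N = e (N - 5); the ranks up to 4 are ordinary reflection extensions. *)
Definition use_crown (e : nat -> bool) (N : nat) : bool :=
  (4 < N) && e (N - 5).

(* [prefix a2 b2 e k] ends in rank k + 3. *)
Fixpoint prefix (a2 b2 : rank2) (e : nat -> bool) (k : nat) : labelled :=
  match k with
  | 0 => advance (reflection front2) a2 b2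
  | k'.+1 =>
      let L := prefix a2 b2 e k' in
      advance (if use_crown e (k' + 4) then crown (lab_b' L) else reflection L)
        (lab_a L) (lab_b L)
  end.

Definition family_front (a2 b2 : rank2) (e : nat -> bool) (n : nat) : frontier :=
  match n with
  | 0 => front0
  | 1 => front1
  | 2 => front2
  | k.+3 => prefix a2 b2 e k
  end.

Definition family_cov (a2 b2 : rank2) (e : nat -> bool) (n : nat) :
    cur (family_front a2 b2 e n) -> cur (family_front a2 b2 e n.+1) -> bool :=
  match n with
  | 0 => fun x y => x \in @low front1 y
  | 1 => fun x y => x \in @low front2 y
  | 2 => fun x y => x \in @low (prefix a2 b2 e 0) y
  | k.+3 => fun x y => x \in @low (prefix a2 b2 e k.+1) y
  end.

Definition Peps (a2 b2 : rank2) (e : nat -> bool) : hasse :=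
  @Hasse (fun n => cur (family_front a2 b2 e n)) (@family_cov a2 b2 e).

(* With m = a_{n-1}, n being the top rank: a_n covers exactly a_{n-1}, b_n covers
   exactly a_{n-1} and b_{n-1}, and a_n, b_n are the upper covers of a_{n-1}.
   So b_n is the unique common upper cover of a_{n-1} and b_{n-1}. *)
Definition good_labels (L : labelled) : Prop :=
  exists m : prev L,
    [/\ m != lab_b' L, low (lab_a L) = [set m],
        low (lab_b L) = [set m; lab_b' L] & up m = [set lab_a L; lab_b L]].

Lemma card_sum_set (A B : finType) (p : pred (A + B)) :
  #|[set u | p u]| = #|[set x | p (inl x)]| + #|[set x | p (inr x)]|.
Proof.
rewrite -!sum1_card !(eq_bigl _ _ (fun=> in_set _ _)) big_sumType.
by congr (_ + _); apply: eq_bigl => x; rewrite inE.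
Qed.

Lemma reflection_D3 (s : frontier) (x : cur s) :
  #|@up (extend (reflection s)) x| = #|low x|.+1.
Proof.
rewrite card_sum_set /= -addn1; congr (_ + _).
  by apply: eq_card => y; rewrite !inE.
by rewrite -(cards1 x); apply: eq_card => y; rewrite !inE eq_sym.
Qed.

Lemma reflection_D2 (s : frontier) (x y : cur s) : x != y ->
  #|@up (extend (reflection s)) x :&: @up (extend (reflection s)) y|
    = #|low x :&: low y|.
Proof.
move=> xy; rewrite [in LHS]/setI card_sum_set -[RHS]addn0; congr (_ + _).
  by apply: eq_card => z; rewrite !inE.
apply: eq_card0 => z; rewrite !inE.
by apply: contraNF xy => /andP[/eqP-> /eqP->].
Qed.

Lemma crown_inl (s : frontier) (y : prev s) (A : {set prev s}) :
  #|[set z : {z | z != y} | val z \in A]| = #|A :\ y|.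
Proof.
rewrite -(card_imset _ val_inj); apply: eq_card => z.
apply/imsetP/setD1P => [[u]|[zy zA]]; first by rewrite inE => uA ->; split => //; exact: (valP u).
by exists (exist _ z zy); rewrite ?inE.
Qed.

Definition crown_low (s : frontier) (y : prev s) (z : cur s) : {set cur s} :=
  if z \in up y then up y :\ z else [set z].

Lemma crown_inr (s : frontier) (y : prev s) (x : cur s) :
  [set z | x \in crown_low y z] = if x \in up y then up y :\ x else [set x].
Proof.
apply/setP => z; rewrite inE /crown_low.
have [->|zx] := eqVneq z x; first by [].
by do 2![case: ifP]; rewrite !inE eq_sym (negPf zx) //= => -> ->.
Qed.

Lemma crown_inr2 (s : frontier) (y : prev s) (x x' : cur s) : x != x' ->
  #|up y| = 3 ->
  #|[set z | (x \in crown_low y z) && (x' \in crown_low y z)]|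
    = (y \in low x :&: low x').
Proof.
move=> xx' y3; have -> : [set z | (x \in crown_low y z) && (x' \in crown_low y z)]
   = [set z | x \in crown_low y z] :&: [set z | x' \in crown_low y z].
  by apply/setP => z; rewrite !inE.
have upE z : (z \in up y) = (y \in low z) by rewrite inE.
rewrite !crown_inr in_setI -!upE.
have [xy|xy] := boolP (x \in up y); have [xy'|xy'] := boolP (x' \in up y) => /=.
- have E1 := cardsD1 x (up y); have E2 := cardsD1 x' (up y :\ x).
  rewrite xy y3 add1n in E1; rewrite in_setD1 eq_sym xx' xy' add1n in E2.
  case: E1 E2 => <- [E2]; rewrite -[RHS]/1 E2; apply: eq_card => z.
  by rewrite !(in_setI, in_setD1); case: (z \in up y); rewrite ?andbT ?andbF 1?andbC.
- apply: eq_card0 => z; rewrite !inE; have [->|] := eqVneq z x'; last by rewrite andbF.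
  by rewrite -upE (negPf xy') andbF.
- apply: eq_card0 => z; rewrite !inE; have [->|] := eqVneq z x; last by [].
  by rewrite -upE (negPf xy) andbF.
- by apply: eq_card0 => z; rewrite !inE; have [->|] := eqVneq z x; rewrite ?(negPf xx').
Qed.

Lemma crown_D3 (s : frontier) (y : prev s) (x : cur s) : #|up y| = 3 ->
  #|@up (extend (crown y)) x| = #|low x|.+1.
Proof.
move=> y3; rewrite card_sum_set /= (crown_inr y x).
have -> : #|[set z : {z | z != y} | x \in up (val z)]| = #|low x :\ y|.
  by rewrite -crown_inl; apply: eq_card => z; rewrite !inE.
have xyE : (x \in up y) = (y \in low x) by rewrite inE.
have := cardsD1 x (up y); rewrite (cardsD1 y (low x)) y3 -xyE.
case: ifP => _ E; last by rewrite cards1 addn1.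
by rewrite add1n in E; case: E => <-; rewrite addn2 add1n.
Qed.

Lemma crown_D2 (s : frontier) (y : prev s) (x x' : cur s) : x != x' ->
  #|up y| = 3 ->
  #|@up (extend (crown y)) x :&: @up (extend (crown y)) x'|
    = #|low x :&: low x'|.
Proof.
move=> xx' y3; rewrite [in LHS]/setI card_sum_set.
rewrite [RHS](cardsD1 y) addnC -(crown_inr2 xx' y3); congr (_ + _).
  by apply: eq_card => z; rewrite !inE.
by rewrite -crown_inl; apply: eq_card => z; rewrite !inE.
Qed.

Lemma crown_low_neq0 (s : frontier) (y : prev s) (u : cur (extend (crown y))) :
  (forall z : prev s, up z != set0) -> #|up y| = 3 -> low u != set0.
Proof.
move=> up0 y3; case: u => [z|x] /=; first exact: up0.
case: ifP => xy; last by rewrite -card_gt0 cards1.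
by have := cardsD1 x (up y); rewrite xy y3 -card_gt0 add1n => -[<-].
Qed.

Lemma reflection_low_neq0 (s : frontier) (u : cur (extend (reflection s))) :
  (forall z : prev s, up z != set0) -> low u != set0.
Proof.
move=> up0; case: u => [z|x] /=; first exact: up0.
by rewrite -card_gt0 cards1.
Qed.

Lemma advance_good (s : frontier) (E : extension s) (a b : cur s)
    (m : prev s) (u v : cur (extend E)) :
  a != b -> up m = [set a; b] -> low u = [set a; b] -> low v = [set a] ->
  @up (extend E) a = [set u; v] -> good_labels (advance E a b).
Proof.
move=> ab mE uE vE aE; have uv : u != v.
  by apply: contraNneq ab => uv; have := in_set2 b a b; rewrite -uE uv vE inE eqxx orbT eq_sym.
have Ea (x : cur (extend E)) : (a \in low x) = (x == u) || (x == v).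
  by have := in_set2 x u v; rewrite -aE inE.
have bE : next_b E a b = u.
  rewrite /next_b; case: pickP => [x|/(_ u)] /=; last by rewrite [newlow u]uE !inE !eqxx orbT.
  rewrite Ea => /andP[/orP[/eqP->//|/eqP->]].
  by rewrite [newlow v]vE inE eq_sym (negPf ab).
have aE' : next_a E a b = v.
  rewrite /next_a bE; case: pickP => [x|/(_ v)] /=; last by rewrite Ea eqxx orbT eq_sym uv.
  by rewrite Ea => /andP[/orP[/eqP->|/eqP->//]]; rewrite eqxx.
by exists a; split; rewrite /= ?bE ?aE' //; rewrite [up _]aE setUC.
Qed.

Lemma good_labels_neq (L : labelled) : good_labels L -> lab_a L != lab_b L.
Proof.
move=> [m [mb' aE bE _]]; apply: contraNneq mb' => ab.
by rewrite eq_sym -in_set1 -aE ab bE !inE eqxx orbT.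
Qed.

Lemma reflection_good (L : labelled) : good_labels L ->
  good_labels (advance (reflection L) (lab_a L) (lab_b L)).
Proof.
move=> gL; have ab := good_labels_neq gL; case: gL => m [mb' aE bE mE].
apply: (@advance_good L (reflection L) _ (lab_b L) m (inl m) (inr (lab_a L))) => //.
apply/setP => -[z|z]; rewrite [LHS]inE /= inE ?aE !inE ?orbF //.
Qed.

Lemma crown_good (L : labelled) : good_labels L ->
  good_labels (advance (crown (lab_b' L)) (lab_a L) (lab_b L)).
Proof.
move=> gL; have ab := good_labels_neq gL; case: gL => m [mb' aE bE mE].
have aN : (lab_a L \in up (lab_b' L)) = false.
  by rewrite inE aE inE eq_sym (negPf mb').
apply: (@advance_good L (crown (lab_b' L)) _ (lab_b L) m
          (inl (exist _ m mb')) (inr (lab_a L))) => //=.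
  by rewrite aN.
apply/setP => -[z|z]; rewrite [LHS]inE /=.
  by rewrite !inE aE inE orbF.
have /setP/(_ z) := crown_inr (lab_b' L) (lab_a L).
by rewrite aN in_set in_set1 => cE; rewrite !inE -[RHS]cE /crown_low inE.
Qed.

Lemma labels_correct (a2 b2 : rank2) (e : nat -> bool) (k : nat) :
  a2 != b2 -> good_labels (prefix a2 b2 e k).
Proof.
move=> ab; elim: k => [|k IH] /=; last first.
  by case: ifP => _; [exact: crown_good | exact: reflection_good].
have r1 (x : cur front1) : x = inr tt by case: x => [[]|[]].
have lE (x : rank2) : @low front2 x = [set inr tt].
  case: x => [x|x] /=; last by rewrite (r1 x).
  by apply/setP => x'; rewrite (r1 x') !inE.
have upE : @up front2 (inr tt) = [set a2; b2].
  apply/setP => x; rewrite inE lE !inE eqxx; move: x a2 b2 ab.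
  by do 3![case=> [[]|[[]|[]]]].
apply: (@advance_good front2 (reflection front2) _ b2 (inr tt)
          (inl (inr tt)) (inr a2)) => //.
apply/setP => -[x|x]; rewrite [LHS]inE /= !inE // (r1 x).
by rewrite [low a2]lE inE eqxx.
Qed.

(* Every crown extension in the family is made at an element with exactly three
   upper covers. *)
Lemma lab_b'_up (a2 b2 : rank2) (e : nat -> bool) (k : nat) : a2 != b2 ->
  use_crown e (k + 4) -> #|up (lab_b' (prefix a2 b2 e k))| = 3.
Proof.
move=> ab; have H j : #|low (lab_b (prefix a2 b2 e j))| = 2.
  case: (labels_correct e j ab) => m [mb' _ -> _].
  by rewrite cards2 mb'.
elim: k => [//|k IH] _ /=.
by case: ifP => [/IH c3|_]; rewrite ?crown_D3 ?reflection_D3 ?H.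
Qed.

Definition extension_ok (s : frontier) (E : extension s) : Prop :=
  (forall x y : cur s, x != y ->
     #|@up (extend E) x :&: @up (extend E) y| = #|low x :&: low y|) /\
  (forall x : cur s, #|@up (extend E) x| = #|low x|.+1).

Lemma reflection_ok (s : frontier) : extension_ok (reflection s).
Proof. by split; [exact: reflection_D2 | exact: reflection_D3]. Qed.

Lemma prefix_ok (a2 b2 : rank2) (e : nat -> bool) (k : nat) : a2 != b2 ->
  extension_ok (if use_crown e (k + 4) then crown (lab_b' (prefix a2 b2 e k))
                else reflection (prefix a2 b2 e k)).
Proof.
move=> ab; case: ifP => [/(lab_b'_up ab) b3|_]; last exact: reflection_ok.
by split=> [x y xy|x]; [exact: crown_D2 | exact: crown_D3].
Qed.

Lemma low_neq0 (a2 b2 : rank2) (e : nat -> bool) (n : nat) : a2 != b2 ->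
  forall x : cur (family_front a2 b2 e n.+1), low x != set0.
Proof.
move=> ab.
have up0 (s : frontier) (E : extension s) : extension_ok E ->
    forall z, @up (extend E) z != set0.
  by move=> [_ D3] z; rewrite -card_gt0 D3.
case: n => [|[|n]].
- by move=> x; apply: reflection_low_neq0 => -[].
- by move=> x; apply: reflection_low_neq0; apply: up0; exact: reflection_ok.
elim: n => [|k _] x.
  by apply: reflection_low_neq0; apply: up0; exact: reflection_ok.
have up1 (z : prev (prefix a2 b2 e k)) : up z != set0.
  case: k {x} z => [|k]; apply: up0; first exact: reflection_ok.
  exact: prefix_ok.
move: x; rewrite /= ; case: ifP => [/(lab_b'_up ab) b3|_] x.
  exact: crown_low_neq0.
exact: reflection_low_neq0.
Qed.

Lemma lower_coversE (a2 b2 : rank2) (e : nat -> bool) (n : nat)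
    (x : rank_elt (Peps a2 b2 e) n.+1) :
  [set y | cov y x] = match n return
      cur (family_front a2 b2 e n.+1) -> {set cur (family_front a2 b2 e n)}
    with
    | 0 => @low front1
    | 1 => @low front2
    | 2 => @low (prefix a2 b2 e 0)
    | k.+3 => @low (prefix a2 b2 e k.+1)
    end x.
Proof. by case: n x => [|[|[|n]]] x; apply/setP => z; rewrite inE. Qed.

Theorem Peps_differential1 (a2 b2 : rank2) (e : nat -> bool) : a2 != b2 ->
  differential1 (Peps a2 b2 e).
Proof.
move=> ab; have D (n : nat) (x y : rank_elt (Peps a2 b2 e) n) :
    #|lower_covers x :&: lower_covers y| = #|low x :&: low y|.
  case: n x y => [|[|[|[|n]]]] x y; rewrite /lower_covers ?lower_coversE //.
  by rewrite !setI0 !cards0.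
split=> [|n x|n x y xy|n x].
- exact: card_unit.
- rewrite -card_gt0 -[lower_covers x]setIid D setIid card_gt0.
  exact: low_neq0.
- rewrite D; case: n x y xy => [|[|[|n]]] x y xy.
  + exact: (reflection_ok front0).1.
  + exact: (reflection_ok front1).1.
  + exact: (reflection_ok front2).1.
  + exact: (prefix_ok e n ab).1.
- rewrite -[lower_covers x]setIid D setIid; case: n x => [|[|[|n]]] x.
  + exact: (reflection_ok front0).2.
  + exact: (reflection_ok front1).2.
  + exact: (reflection_ok front2).2.
  + exact: (prefix_ok e n ab).2.
Qed.

(* Formal power series are represented by their coefficient sequences. *)
From mathcomp Require Import boolp classical_sets cardinality reals.
Import Order.TTheory GRing.Theory Num.Theory.

Local Open Scope ring_scope.

Definition series (R : Type) : Type := nat -> R.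

Definition series_mul (R : pzRingType) (f g : series R) : series R :=
  fun n => \sum_(i < n.+1) f i * g (n - i)%N.

(* The first n coefficients of the quotient f / g when the constant term of g
   is 1. *)
Fixpoint series_div_seq (R : pzRingType) (f g : series R) (n : nat) : seq R :=
  if n is m.+1 then
    let s := series_div_seq f g m in
    rcons s (f m - \sum_(i < m) s`_i * g (m - i)%N)
  else [::].

Definition series_div (R : pzRingType) (f g : series R) : series R :=
  fun n => (series_div_seq f g n.+1)`_n.

Lemma size_series_div_seq (R : pzRingType) (f g : series R) (n : nat) :
  size (series_div_seq f g n) = n.
Proof. by elim: n => //= n IH; rewrite size_rcons IH. Qed.

Lemma nth_series_div_seq (R : pzRingType) (f g : series R) (n i : nat) :
  (i < n)%N -> (series_div_seq f g n)`_i = series_div f g i.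
Proof.
elim: n => // n IH; rewrite ltnS leq_eqVlt => /orP[/eqP->//|lt_in].
by rewrite [LHS]nth_rcons size_series_div_seq lt_in IH.
Qed.

Lemma series_divK (R : pzRingType) (f g : series R) :
  g 0%N = 1 -> series_mul (series_div f g) g = f.
Proof.
move=> g0; apply: funext => n; rewrite /series_mul big_ord_recr /= subnn g0 mulr1.
rewrite {2}/series_div /= nth_rcons size_series_div_seq ltnn eqxx.
under [X in _ + (_ - X)]eq_bigr => i _ do rewrite nth_series_div_seq //.
by rewrite addrC subrK.
Qed.

Definition rank_series (P : hasse) : series int :=
  fun n => #|rank_elt P n|%:Z.

(* The coefficient of q^n counts the pairs x1 <= x2 of elements whose ranks
   add up to n; the condition 0 <= x1 always holds. *)
Definition M2_series (P : hasse) : series int :=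
  fun n => \sum_(i < n.+1)
    #|[pred p : rank_elt P i * rank_elt P (n - i)%N |
       `[< hle (existT _ (nat_of_ord i) p.1) (existT _ (n - i)%N p.2) >]]|%:Z.

Definition Q_series (P : hasse) : series int :=
  series_div (M2_series P) (series_mul (rank_series P) (rank_series P)).

Lemma Q_seriesP (P : hasse) : #|rank_elt P 0| = 1%N ->
  series_mul (Q_series P) (series_mul (rank_series P) (rank_series P))
    = M2_series P.
Proof.
by move=> P0; apply: series_divK; rewrite /series_mul big_ord1 /rank_series P0.
Qed.

Definition rational_over (K : fieldType) (S : series rat) : Prop :=
  exists A B : {poly K}, B != 0 /\
    series_mul (fun n => B`_n) (fun n => ratr (S n)) = (fun n => A`_n).

Definition int_series_rat (S : series int) : series rat := fun n => (S n)%:~R.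

Local Open Scope classical_set_scope.
Local Open Scope card_scope.

Definition quotient_set (a2 b2 : rank2) : set (series int) :=
  range (fun e : nat -> bool => Q_series (Peps a2 b2 e)).

Definition nowhere_rational (S : series int) : Prop :=
  forall K : fieldType, [pchar K] =i pred0 ->
    ~ rational_over K (int_series_rat S).

(* [R] is a model of the real numbers. *)
Definition continuum_many (R : realType) (T : Type) (A : set T) : Prop :=
  A #= [set: R].

(* Main.v *)
From mathcomp Require Import all_boot all_order all_algebra.
From Stdlib Require Import Relation_Operators Operators_Properties.
From mathcomp Require Import boolp classical_sets functions cardinality reals.
From mathcomp Require Import ring lra zify.
Require Import Defs.

(** The quotient series determines the binary sequence, and only countably many
    integer series are rational; the theorem is then a count.

    Let e and e' first differ at j, with e j = 0 and e' j = 1, and put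
    N = j + 5.  The two posets have the same ranks below N, and the crown
    replaces four elements by three, so the rank sizes satisfy
    p_N = p'_N + 1 ([card_rank_split]).  In M_2 = sum of q^(rho x1 + rho x2)
    over x1 <= x2, a pair of total rank N either lies below rank N, where both
    posets agree, or consists of the bottom element and an element of rank N; so
    the coefficient of q^N in M_2 also differs by exactly 1
    ([M2_series_split]).  In F^2 = (sum of p_n q^n)^2 it differs by
    2 p_0 = 2, because p_N is multiplied by p_0 twice.  If both posets had the
    same quotient Q, comparing the coefficients of q^N in M_2 = Q F^2 would give
    1 = 2 Q_0 with Q_0 an integer, which is absurd.  Hence e |-> Q is injective
    ([Q_series_inj]), and the set of quotients has the cardinality of
    {0,1}^nat, which is that of the reals ([card_cantor_real]).

    A series S is rational when some nonzero B makes almost all coefficients of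
    B S vanish, a homogeneous linear system whose matrix consists of
    coefficients of S.  For an integer series the existence of a nonzero
    solution does not depend on the field of characteristic zero, so a series
    rational over any such field is rational over the rational numbers
    ([rational_descent]) and is determined by two polynomials with rational
    coefficients.  Therefore only countably many sequences e give a rational
    quotient.  Interleaving splits {0,1}^nat into continuum many disjoint copies
    of itself, one for each value of the odd-indexed entries; since countably
    many sequences cannot meet all copies ([interleave_avoids_countable]), some
    copy gives continuum many nowhere rational quotients. *)

Set Implicit Arguments.
Unset Strict Implicit.
Unset Printing Implicit Defensive.
Import Order.TTheory GRing.Theory Num.Theory.
Local Open Scope ring_scope.

(** * Sets of continuum cardinality *)

Lemma first_difference (e e' : nat -> bool) : e <> e' ->
  exists j, (forall i, (i < j)%N -> e i = e' i) /\ e j != e' j.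
Proof.
move=> ne; have exk : exists k, e k != e' k.
  apply: contrapT => /forallNP eq_e; apply: ne; apply: funext => k.
  by apply/eqP/negPn/negP.
case: (ex_minnP exk) => j ej minj; exists j; split=> // i ij.
by apply/eqP; apply: contraTT ij => /minj; rewrite -leqNgt.
Qed.

Lemma injective_card_le (T U : Type) (f : T -> U) (A : set U) :
  injective f -> (forall t, A (f t)) -> ([set: T] #<= A)%card.
Proof.
move=> fI fA; have : (f @` [set: T] #= [set: T])%card.
  by apply: inj_card_eq => x y _ _; exact: fI.
rewrite card_eq_le => /andP[_ le]; apply: (card_le_trans le).
by apply: subset_card_le => _ [t _ <-].
Qed.

(** The number with base 3 digits [b], up to a factor 3.  Base 3 rather than 2
    because with digits 0 and 1 only it makes the expansion unique: everything
    after a digit is worth at most half of a unit of that digit. *)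
Definition ternary_sum (R : realType) (b : nat -> bool) (n : nat) : R :=
  \sum_(i < n) (b i)%:R / 3 ^+ i.

Lemma ternary_sumS (R : realType) (b : nat -> bool) (n : nat) :
  ternary_sum R b n.+1 = ternary_sum R b n + (b n)%:R / 3 ^+ n.
Proof. by rewrite /ternary_sum big_ord_recr. Qed.

Lemma ternary_sum_mono (R : realType) (b : nat -> bool) (m n : nat) :
  (m <= n)%N -> ternary_sum R b m <= ternary_sum R b n.
Proof.
move=> /subnKC <-; elim: (n - m)%N => [|k IH]; first by rewrite addn0.
by rewrite addnS ternary_sumS (le_trans IH) // lerDl divr_ge0 ?exprn_ge0.
Qed.

(** The constant is that of the geometric series: the terms of index at least
    [n] add up to at most (3 / 2) / 3 ^ n, so partial sum plus this bound does
    not increase with [n]. *)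
Lemma ternary_sum_tail (R : realType) (b : nat -> bool) (m n : nat) :
  ternary_sum R b m <= ternary_sum R b n + 3 / 2 / 3 ^+ n.
Proof.
have [mn|nm] := leqP m n.
  by rewrite (le_trans (ternary_sum_mono _ _ mn)) // lerDl divr_ge0 ?exprn_ge0 ?divr_ge0.
have decr k : ternary_sum R b k.+1 + 3 / 2 / 3 ^+ k.+1
           <= ternary_sum R b k + 3 / 2 / 3 ^+ k.
  rewrite ternary_sumS exprSr invfM.
  have p : 0 <= (3 ^+ k)^-1 :> R by rewrite invr_ge0 exprn_ge0.
  by move: p; case: (b k); rewrite ?mul1r ?mul0r; lra.
have {nm} : ternary_sum R b m + 3 / 2 / 3 ^+ m
         <= ternary_sum R b n + 3 / 2 / 3 ^+ n.
  move: (ltnW nm) => /subnKC <-; elim: (m - n)%N => [|k IH]; first by rewrite addn0.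
  by rewrite addnS (le_trans (decr _)).
by apply: le_trans; rewrite lerDl divr_ge0 ?exprn_ge0 ?divr_ge0.
Qed.

Definition ternary (R : realType) (b : nat -> bool) : R :=
  sup (range (ternary_sum R b)).

Lemma ternary_sum_le (R : realType) (b : nat -> bool) (n : nat) :
  ternary_sum R b n <= ternary R b.
Proof.
apply: ub_le_sup; last by exists n.
by exists (ternary_sum R b 0 + 3 / 2 / 3 ^+ 0) => _ [m _ <-]; exact: ternary_sum_tail.
Qed.

Lemma ternary_le (R : realType) (b : nat -> bool) (n : nat) :
  ternary R b <= ternary_sum R b n + 3 / 2 / 3 ^+ n.
Proof.
apply: ge_sup => [|_ [m _ <-]]; last exact: ternary_sum_tail.
by exists (ternary_sum R b 0), 0%N.
Qed.

(** At the first difference [j] the sequence with digit 1 has gained 1 / 3 ^ j,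
    twice what the other one can still catch up. *)
Lemma ternary_inj (R : realType) : injective (ternary R).
Proof.
suff lt b b' j : (forall i, (i < j)%N -> b i = b' i) -> ~~ b j -> b' j ->
    ternary R b < ternary R b'.
  move=> b b' E; apply: contrapT => /first_difference[j [bb' bj]].
  case bjE : (b j) bj; case b'jE : (b' j) => // _.
    have := lt b' b j (fun i ij => esym (bb' i ij)).
    by rewrite b'jE bjE E ltxx => /(_ isT isT).
  by have := lt b b' j bb'; rewrite b'jE bjE E ltxx => /(_ isT isT).
move=> bb' bj b'j; apply: le_lt_trans (ternary_le R b j.+1) _.
apply: lt_le_trans (ternary_sum_le R b' j.+1).
rewrite !ternary_sumS b'j (negPf bj) exprSr invfM.
have -> : ternary_sum R b j = ternary_sum R b' j.
  by apply: eq_bigr => i _; rewrite bb'.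
have p : 0 < (3 ^+ j)^-1 :> R by rewrite invr_gt0 exprn_gt0.
by move: p; rewrite mul0r mul1r; lra.
Qed.

(** A real number is coded by its Dedekind cut, transported from the rationals
    to the natural numbers by their enumeration. *)
Definition rational_cut (R : realType) (x : R) (n : nat) : bool :=
  if unpickle n is Some q then ratr (q : rat) < x else false.

Lemma rational_cut_inj (R : realType) : injective (@rational_cut R).
Proof.
suff lt (x y : R) : x < y -> rational_cut x <> rational_cut y.
  by move=> x y E; case: (ltgtP x y) => // /lt; rewrite E.
move=> /rat_in_itvoo[q]; rewrite in_itv /= => /andP[xq qy].
move=> /(congr1 (fun c => c (pickle q))); rewrite /rational_cut pickleK qy.
by rewrite ltNge (ltW xq).
Qed.

Lemma card_cantor_real (R : realType) :
  ([set: nat -> bool] #= [set: R])%card.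
Proof.
rewrite card_eq_le (injective_card_le (@ternary_inj R)) //=.
exact: injective_card_le (@rational_cut_inj R) _.
Qed.

(** Cantor's diagonal argument: injectivity of [g] gives
    [D (g z) = ~~ z (g z)] for every [z], in particular for [z = D]. *)
Lemma no_injection_cantor_nat (g : (nat -> bool) -> nat) : ~ injective g.
Proof.
move=> gI; pose D n := `[< exists2 z, g z = n & ~~ z n >].
have DE : D (g D) = ~~ D (g D).
  apply/idP/idP => [/asboolP[z /gI->]//|nD].
  by apply/asboolP; exists D.
by case: (D (g D)) DE.
Qed.

Definition interleave (x y : nat -> bool) (n : nat) : bool :=
  if odd n then y n./2 else x n./2.

Lemma interleave_inj (x x' y y' : nat -> bool) :
  interleave x y = interleave x' y' -> x = x' /\ y = y'.
Proof.
move=> E; split; apply: funext => n.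
  by have := congr1 (fun f => f n.*2) E; rewrite /interleave odd_double doubleK.
by have := congr1 (fun f => f n.*2.+1) E; rewrite /interleave /= odd_double uphalf_double.
Qed.

(** If every fibre [{interleave x y | x}] met [B], choosing a point of [B] in
    each of these pairwise disjoint fibres would inject the uncountable set of
    all [y] into [B]. *)
Lemma interleave_avoids_countable (B : set (nat -> bool)) : countable B ->
  exists y, forall x, ~ B (interleave x y).
Proof.
move=> /countable_injP[f fI]; apply: contrapT => /forallNP H.
have {H} /choice[s sB] : forall y, exists x, B (interleave x y).
  by move=> y; have /existsNP[x /contrapT] := H y; exists x.
apply: (@no_injection_cantor_nat (fun y => f (interleave (s y) y))) => y y' E.
by have [] := interleave_inj (fI _ _ (mem_set (sB y)) (mem_set (sB y')) E).
Qed.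

(** The reals, the Cantor space and [A] are compared by the
    Cantor-Bernstein theorem. *)
Lemma continuum_many_image (R : realType) (T : Type) (q : (nat -> bool) -> T)
    (A : set T) :
  (A `<=` range q)%classic ->
  (exists2 g : (nat -> bool) -> nat -> bool,
     injective (q \o g) & forall x, A (q (g x))) ->
  continuum_many R A.
Proof.
move=> Aq [g qgI qgA].
have qT : (A #<= [set: nat -> bool])%card.
  exact: card_le_trans (subset_card_le Aq) (card_image_le _ _).
rewrite /continuum_many -(card_eqr (card_cantor_real R)) card_eq_le qT.
exact: injective_card_le qgI qgA.
Qed.

(** * Rationality of integer series over fields of characteristic zero *)

Lemma intr_eq0_pchar0 (K : idomainType) (z : int) :
  [pchar K] =i pred0 -> (z%:~R == 0 :> K) = (z == 0).
Proof.
move=> /(pcharf0P K).1 K0; case: (intP z) => [|n|n]; rewrite ?eqxx //.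
  by rewrite -pmulrn K0.
by rewrite mulrNz oppr_eq0 -pmulrn K0 oppr_eq0.
Qed.

(** A square minor of [A] is an integer, so it vanishes in [K] exactly when it
    vanishes over the rationals; a matrix of full column rank over the rationals
    has a nonzero maximal minor, hence no kernel over [K]. *)
Lemma int_mx_kernel_descent (K : fieldType) (m n : nat) (A : 'M[int]_(m, n))
    (v : 'cV[K]_n) :
  [pchar K] =i pred0 -> v != 0 -> map_mx intr A *m v = 0 ->
  (\rank (map_mx intr A : 'M[rat]_(m, n)) < n)%N.
Proof.
move=> K0 v0 Av; rewrite ltnNge col_leq_rank; apply: contra v0 => full.
set f := fullrankfun full; pose B := rowsub f A.
have detB : \det B != 0.
  have := fullrowsub_unit full.
  have -> : rowsub (fullrankfun full) (map_mx intr A) = map_mx intr B :> 'M[rat]_n.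
    by apply/matrixP => i k; rewrite !mxE.
  by rewrite unitmxE det_map_mx unitfE intr_eq0.
have uB : map_mx intr B \in @unitmx K n.
  by rewrite unitmxE det_map_mx unitfE intr_eq0_pchar0.
rewrite -(mulKmx uB v).
have -> : map_mx intr B *m v = rowsub f (map_mx intr A *m v).
  by apply/matrixP => i k; rewrite !mxE; apply: eq_bigr => l _; rewrite !mxE.
rewrite Av (_ : rowsub f 0 = 0) ?mulmx0 //.
by apply/matrixP => i k; rewrite !mxE.
Qed.

(** Infinitely many linear equations in [n] unknowns reduce to finitely many:
    once the rank of an initial segment is maximal, every further equation lies
    in the span of that segment. *)
Lemma common_kernel_vector (F : fieldType) (n : nat) (r : nat -> 'rV[F]_n) :
  (forall m, (\rank (\matrix_(i < m) r i) < n)%N) ->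
  exists2 v : 'cV[F]_n, v != 0 & forall i, r i *m v = 0.
Proof.
move=> rk; pose M m := \matrix_(i < m) r i.
have ex_rk : exists k, `[< exists m, \rank (M m) = k >].
  by exists (\rank (M 0)); apply/asboolP; exists 0%N.
have bound k : `[< exists m, \rank (M m) = k >] -> (k <= n)%N.
  by case/asboolP => m <-; apply: ltnW.
case: (ex_maxnP ex_rk bound) => k /asboolP[m mk] maxk.
have : kermx (M m)^T != 0.
  by rewrite -mxrank_eq0 mxrank_ker mxrank_tr -lt0n subn_gt0.
case/rowV0Pn => u /sub_kermxP uM u0; exists u^T.
  by apply: contra u0 => /eqP u0; rewrite -[u]trmxK u0 trmx0.
have Mu : M m *m u^T = 0 by rewrite -[LHS]trmxK trmx_mul trmxK uM trmx0.
have sub m1 m2 : (m1 <= m2)%N -> (M m1 <= M m2)%MS.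
  move=> le12; apply/row_subP => i; rewrite rowK.
  by rewrite -[r i](rowK (fun j : 'I_m2 => r j) (widen_ord le12 i)) row_sub.
move=> i; pose m' := maxn m i.+1.
have lem : (M m' <= M m)%MS.
  rewrite -(geq_leqif (mxrank_leqif_sup (sub _ _ (leq_maxl m i.+1)))) mk.
  by apply: maxk; apply/asboolP; exists m'.
have im : (i < m')%N by rewrite leq_maxr.
have ri : (r i <= M m)%MS.
  apply: submx_trans lem.
  by rewrite -[r i](rowK (fun j : 'I_m' => r j) (Ordinal im)) row_sub.
by case/submxP: ri => D ->; rewrite -mulmxA Mu mulmx0.
Qed.

(** The equations are the vanishing of the coefficients of [B * S] of index
    [a + k], where [a] exceeds both the degree of [A], so that they do vanish,
    and the degree of [B], so that each involves all coefficients of [B]. *)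
Lemma rational_descent (K : fieldType) (S : series int) : [pchar K] =i pred0 ->
  rational_over K (int_series_rat S) ->
  rational_over rat (int_series_rat S).
Proof.
move=> K0 [A [B [B0 BS]]].
pose d := size B; pose a := maxn d (size A).
have SE (F : unitRingType) n : ratr (int_series_rat S n) = (S n)%:~R :> F.
  by rewrite /int_series_rat ratr_int.
pose row_ (k : nat) : 'rV[int]_d := \row_(i < d) S (a + k - i)%N.
have mulE (F : fieldType) (P : {poly F}) k : (size P <= d)%N ->
    series_mul (fun n => P`_n) (fun n => ratr (int_series_rat S n)) (a + k)%N
    = \sum_(i < d) P`_i * (S (a + k - i)%N)%:~R.
  move=> Pd; rewrite /series_mul.
  have le : (d <= (a + k).+1)%N by rewrite /a; lia.
  rewrite (big_ord_widen _ (fun i => P`_i * (S (a + k - i)%N)%:~R) le).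
  rewrite [RHS]big_mkcond; apply: eq_bigr => i _; rewrite SE.
  by case: ltnP => // di; rewrite nth_default ?mul0r // (leq_trans Pd).
pose v : 'cV[K]_d := \col_i B`_i.
have v0 : v != 0.
  apply: contra B0 => /eqP/matrixP v0; apply/eqP/polyP => i; rewrite coef0.
  have [id|] := ltnP i d; last exact: nth_default.
  by have := v0 (Ordinal id) ord0; rewrite !mxE.
have rk m : (\rank (\matrix_(k < m) map_mx intr (row_ k) : 'M[rat]_(m, d)) < d)%N.
  have -> : \matrix_(k < m) map_mx intr (row_ k)
      = map_mx (intr : int -> rat) (\matrix_(k < m) row_ k).
    by apply/matrixP => k i; rewrite !mxE.
  apply: (int_mx_kernel_descent K0 v0); apply/matrixP => k z; rewrite !mxE.
  have := congr1 (fun f => f (a + k)%N) BS; rewrite /= mulE //.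
  rewrite [A`__]nth_default; last by rewrite (leq_trans (leq_maxr d _)) ?leq_addr.
  by move=> SB; rewrite -[RHS]SB; apply: eq_bigr => i _; rewrite !mxE mulrC.
have [w w0 wE] := @common_kernel_vector rat d (fun k => map_mx intr (row_ k)) rk.
pose P : {poly rat} := \poly_(i < d) (if insub i is Some j then w j 0 else 0).
have PE (i : 'I_d) : P`_i = w i 0 by rewrite coef_poly ltn_ord valK.
pose PS := series_mul (fun n => P`_n) (fun n => ratr (int_series_rat S n)).
exists (\poly_(n < a) PS n), P; split.
  apply: contra w0 => /eqP P0; apply/eqP/matrixP => i z.
  by rewrite ord1 -PE P0 coef0 mxE.
apply: funext => n; rewrite coef_poly; case: ltnP => // an.
rewrite -(subnKC an) mulE ?size_poly //.
have /matrixP/(_ 0 0) := wE (n - a)%N; rewrite !mxE => wS; rewrite -[RHS]wS.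
by apply: eq_bigr => i _; rewrite !mxE PE mulrC.
Qed.

(** The ring of formal power series has no zero divisors; the coefficients are
    compared starting from the lowest nonzero coefficient of [B]. *)
Lemma rational_series_unique (S S' : series rat) (A B : {poly rat}) : B != 0 ->
  series_mul (fun n => B`_n) S = (fun n => A`_n) ->
  series_mul (fun n => B`_n) S' = (fun n => A`_n) -> S = S'.
Proof.
move=> B0 <-.
have ex : exists k, B`_k != 0 by exists (size B).-1; rewrite -lead_coefE lead_coef_eq0.
case: (ex_minnP ex) => k Bk mink.
have low i : (i < k)%N -> B`_i = 0.
  by move=> ik; apply/eqP; apply: contraTT ik => /mink; rewrite -leqNgt.
move=> SS'; apply: funext => n; elim/ltn_ind: n => n IH.
have /= := congr1 (fun f => f (n + k)%N) SS'.
have kn : (k < (n + k).+1)%N by lia.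
rewrite /series_mul (bigD1 (Ordinal kn)) // [in RHS](bigD1 (Ordinal kn)) //= addnK.
rewrite (eq_bigr (fun i : 'I_(n + k).+1 => B`_i * S (n + k - i)%N)).
  by move=> /addIr /(mulfI Bk).
move=> i; rewrite -val_eqE /= => ik; have [/low->|ki] := ltnP i k; first by rewrite !mul0r.
by rewrite IH //; have := ltn_ord i; lia.
Qed.

Lemma countable_rational : countable [set S | ~ nowhere_rational S]%classic.
Proof.
pose W (S : series int) (AB : {poly rat} * {poly rat}) := AB.2 != 0 /\
  series_mul (fun n => AB.2`_n) (fun n => ratr (int_series_rat S n))
    = (fun n => AB.1`_n).
have /choice[w wP] : forall S, exists AB, ~ nowhere_rational S -> W S AB.
  move=> S; have [SK|nS] := pselect (nowhere_rational S); first by exists (0, 0).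
  have /existsNP[K /not_implyP[K0 /contrapT SK]] := nS.
  by case: (rational_descent K0 SK) => A [B [B0 BS]]; exists (A, B).
apply/countable_injP; exists (pickle \o w) => S S' /set_mem nS /set_mem nS'.
move=> /(pcan_inj pickleK) wE; have [B0 BS] := wP S nS; have [_] := wP S' nS'.
rewrite -wE => BS'; have SS' := rational_series_unique B0 BS BS'.
apply: funext => n; have := congr1 (fun f => f n) SS'.
by rewrite /int_series_rat !ratr_int => /intr_inj.
Qed.

(** * Order relation and rank sizes of two posets with a common prefix *)

Local Open Scope nat_scope.

Lemma hle_rank (P : hasse) (u v : elt P) : hle u v -> tag u <= tag v.
Proof.
elim=> {u v} [_ _ [n x y _]|//|u v w _ uv _]; first exact: leqnSn.
exact: leq_trans.
Qed.

(** Only the ranks below [N] are mapped: a chain that ends at rank less than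
    [N] never leaves them. *)
Lemma hle_transport (P P' : hasse) (N : nat)
    (f : forall n, n < N -> rank_elt P n -> rank_elt P' n) :
  (forall n (h : n < N) (h1 : n.+1 < N) x y,
     cov x y -> cov (f n h x) (f n.+1 h1 y)) ->
  forall u v : elt P, hle u v -> forall (hu : tag u < N) (hv : tag v < N),
    hle (existT (fun n => rank_elt P' n) (tag u) (f _ hu (tagged u)))
        (existT (fun n => rank_elt P' n) (tag v) (f _ hv (tagged v))).
Proof.
move=> fcov u v /clos_rt_rtn1_iff; elim=> [|w z wz _ IH] hu hv.
  by rewrite (bool_irrelevance hu hv); exact: rt_refl.
case: wz hv IH => n x y xy hv IH.
apply: (rt_trans _ _ _ _ _ (IH hu (ltnW hv))); apply: rt_step.
by constructor; exact: fcov.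
Qed.

Lemma hle_bottom (P : hasse) : differential1 P ->
  forall n (x : rank_elt P 0) (y : rank_elt P n),
    hle (existT (fun n => rank_elt P n) 0 x) (existT (fun n => rank_elt P n) n y).
Proof.
move=> [P0 low0 _ _] n x; elim: n => [|n IH] y.
  have /fintype_le1P/(_ x)-> := eq_leq P0; exact: rt_refl.
have /set0Pn[z] := low0 n y; rewrite inE => zy.
exact: rt_trans (IH z) (rt_step _ _ _ _ (Covered zy)).
Qed.

Definition hle_pairs (P : hasse) (i j : nat) : nat :=
  #|[pred p : rank_elt P i * rank_elt P j |
      `[< hle (existT (fun n => rank_elt P n) i p.1)
              (existT (fun n => rank_elt P n) j p.2) >]]|.

Lemma hle_pairs_bottom (P : hasse) (n : nat) : differential1 P ->
  hle_pairs P 0 n = #|rank_elt P n|.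
Proof.
move=> dP; rewrite -[RHS]mul1n -[in RHS](let: And4 P0 _ _ _ := dP in P0) -card_prod.
by apply: eq_card => p; rewrite !inE; apply/asboolP; exact: hle_bottom.
Qed.

Lemma hle_pairs_gt (P : hasse) (i j : nat) : j < i -> hle_pairs P i j = 0.
Proof.
move=> ji; apply: eq_card0 => p; rewrite inE; apply/asboolP => /hle_rank.
by rewrite /= leqNgt ji.
Qed.

Lemma M2_seriesE (P : hasse) (n : nat) :
  M2_series P n = (\sum_(i < n.+1) (hle_pairs P i (n - i))%:Z)%R.
Proof. by []. Qed.

(** Equal prefixes are Leibniz equal but their element types are not
    convertible, so elements are identified by transport. *)
Definition castF (A B : finType) (E : A = B) : A -> B :=
  let: erefl := E in id.

Lemma castF_inj (A B : finType) (E : A = B) : injective (castF E).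
Proof. by case: _ / E. Qed.

Lemma low_castF (s s' : frontier) (E : s = s') (x : prev s) (y : cur s) :
  (castF (congr1 prev E) x \in low (castF (congr1 cur E) y)) = (x \in low y).
Proof. by case: _ / E. Qed.

Lemma prefix_agree (a2 b2 : rank2) (e e' : nat -> bool) (j k : nat) :
  (forall i, i < j -> e i = e' i) -> k <= j.+1 ->
  prefix a2 b2 e k = prefix a2 b2 e' k.
Proof.
move=> ee'; elim: k => //= k IH kj; rewrite -(IH (ltnW kj)).
suff -> : use_crown e (k + 4) = use_crown e' (k + 4) by [].
rewrite /use_crown; case: k {IH} kj => // k kj.
by rewrite ee' //; lia.
Qed.

Lemma family_front_agree (a2 b2 : rank2) (e e' : nat -> bool) (j n : nat) :
  (forall i, i < j -> e i = e' i) -> n < j + 5 ->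
  family_front a2 b2 e n = family_front a2 b2 e' n.
Proof.
move=> ee'; case: n => [|[|[|k]]] //= kj.
by rewrite (prefix_agree a2 b2 ee') //; lia.
Qed.

(** The elements covered by [y] are read off the top frontier, as elements of
    its last but one rank, whereas [x] belongs to the top rank of the previous
    frontier.  These types coincide, and so do the two transports because
    equality proofs are irrelevant. *)
Lemma family_cov_cast (a2 b2 : rank2) (e e' : nat -> bool) (n : nat)
    (E : family_front a2 b2 e n = family_front a2 b2 e' n)
    (E1 : family_front a2 b2 e n.+1 = family_front a2 b2 e' n.+1)
    (x : cur (family_front a2 b2 e n)) (y : cur (family_front a2 b2 e n.+1)) :
  family_cov (castF (congr1 cur E) x) (castF (congr1 cur E1) y)
    = family_cov x y.
Proof.
case: n E E1 x y => [|[|[|k]]] E E1 x y; rewrite /family_cov -[RHS](low_castF E1);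
  rewrite [congr1 cur E](Prop_irrelevance _ (congr1 prev E1)) //.
Qed.

Lemma hle_pairs_agree (a2 b2 : rank2) (e e' : nat -> bool) (j m n : nat) :
  (forall i, i < j -> e i = e' i) -> m < j + 5 -> n < j + 5 ->
  hle_pairs (Peps a2 b2 e) m n = hle_pairs (Peps a2 b2 e') m n.
Proof.
move=> ee' mj nj.
suff le d d' : (forall i, i < j -> d i = d' i) ->
    hle_pairs (Peps a2 b2 d) m n <= hle_pairs (Peps a2 b2 d') m n.
  by apply/eqP; rewrite eqn_leq !le // => i ij; rewrite ee'.
move=> dd'.
pose f k (h : k < j + 5) : rank_elt (Peps a2 b2 d) k -> rank_elt (Peps a2 b2 d') k :=
  castF (congr1 cur (family_front_agree a2 b2 dd' h)).
have fI k h : injective (@f k h) by exact: castF_inj.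
have fcov k (h : k < j + 5) (h1 : k.+1 < j + 5) x y :
    @cov (Peps a2 b2 d) k x y -> @cov (Peps a2 b2 d') k (f k h x) (f k.+1 h1 y).
  by rewrite [X in _ -> is_true X]family_cov_cast.
pose g (p : rank_elt (Peps a2 b2 d) m * rank_elt (Peps a2 b2 d) n) :=
  (f m mj p.1, f n nj p.2).
have gI : injective g by move=> [x y] [x' y'] [/fI-> /fI->].
rewrite /hle_pairs -(fintype.card_image gI); apply: subset_leq_card.
apply/fintype.subsetP => _ /fintype.imageP[p + ->]; rewrite !inE => le.
exact: (hle_transport fcov le mj nj).
Qed.

Lemma rank_series_agree (a2 b2 : rank2) (e e' : nat -> bool) (j n : nat) :
  (forall i, i < j -> e i = e' i) -> n < j + 5 ->
  rank_series (Peps a2 b2 e) n = rank_series (Peps a2 b2 e') n.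
Proof. by move=> ee' nj; rewrite /rank_series /= (family_front_agree a2 b2 ee' nj). Qed.

Lemma card_next_rank (a2 b2 : rank2) (e : nat -> bool) (k : nat) :
  #|cur (prefix a2 b2 e k.+1)|
    = #|prev (prefix a2 b2 e k)| - use_crown e (k + 4) + #|cur (prefix a2 b2 e k)|.
Proof.
rewrite /=; case: ifP => _; rewrite card_sum ?subn0 //= card_sig.
rewrite [in RHS](cardD1 (lab_b' (prefix a2 b2 e k))) inE addKn.
by congr (_ + _); apply: eq_card => z; rewrite !inE andbT.
Qed.

(** The crown deletes the element attached to its base and only changes the
    lower covers of the others. *)
Lemma card_rank_split (a2 b2 : rank2) (e e' : nat -> bool) (j : nat) :
  (forall i, i < j -> e i = e' i) -> ~~ e j -> e' j ->
  #|rank_elt (Peps a2 b2 e) (j + 5)| = #|rank_elt (Peps a2 b2 e') (j + 5)|.+1.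
Proof.
move=> ee' ej e'j; rewrite (addnC j) -[5 + j]/(j.+2.+3).
change (#|cur (prefix a2 b2 e j.+2)| = #|cur (prefix a2 b2 e' j.+2)|.+1).
rewrite (card_next_rank a2 b2 e) (card_next_rank a2 b2 e').
rewrite (prefix_agree a2 b2 ee' (leqnn _)) /use_crown.
have [Ej ->] : j.+1 + 4 - 5 = j /\ 4 < j.+1 + 4 by lia.
rewrite Ej (negPf ej) e'j subn0.
by rewrite (cardD1 (lab_b' (prefix a2 b2 e' j.+1))) inE addKn -addSn.
Qed.

Local Open Scope ring_scope.

(** * Injectivity of the quotient series *)

(** Of the pairs whose ranks add up to [j + 5], those with the bottom element
    below account for the difference; those of ranks [j + 5] and 0 in this
    order do not exist, and the remaining ones lie in the common prefix. *)
Lemma M2_series_split (a2 b2 : rank2) (e e' : nat -> bool) (j : nat) : a2 != b2 ->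
  (forall i, (i < j)%N -> e i = e' i) -> ~~ e j -> e' j ->
  M2_series (Peps a2 b2 e) (j + 5) = M2_series (Peps a2 b2 e') (j + 5) + 1.
Proof.
move=> ab ee' ej e'j; rewrite !M2_seriesE !big_ord_recl /= subn0.
rewrite !hle_pairs_bottom; try exact: Peps_differential1.
rewrite (card_rank_split a2 b2 ee' ej e'j) -addn1 PoszD [LHS]addrAC; congr (_ + _ + _).
apply: eq_bigr => i _; congr _%:Z; rewrite /bump /= add1n.
have [ij|ij] := ltnP i.+1 (j + 5).
  by apply: (hle_pairs_agree a2 b2 ee' ij); lia.
by rewrite !hle_pairs_gt //; lia.
Qed.

(** Only the two extreme terms of the convolution see the first possible
    difference. *)
Lemma series_mul_split (R : comNzRingType) (f f' g g' : series R) (n : nat) :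
  (forall i, (i < n)%N -> f i = f' i) -> (forall i, (i < n)%N -> g i = g' i) ->
  (0 < n)%N ->
  series_mul f g n - series_mul f' g' n
    = (f n - f' n) * g 0%N + f 0%N * (g n - g' n).
Proof.
case: n => // n ff' gg' _; rewrite /series_mul !(big_ord_recl n.+1) !(big_ord_recr n) /=.
rewrite [bump 0 n]add1n subnn !subn0 (ff' 0%N) // (gg' 0%N) //.
rewrite (eq_bigr (fun i : 'I_n => f' (bump 0 i) * g' (n.+1 - bump 0 i)%N)).
  ring.
by move=> i _; rewrite ff' ?gg' //; case: i => i /=; rewrite /bump; lia.
Qed.

(** With p_N - p'_N = 1 and a common quotient Q, the coefficients of q^N in
    M_2 = Q F^2 differ by 1 on the left and by 2 Q_0 on the right. *)
Lemma Q_series_split (a2 b2 : rank2) (e e' : nat -> bool) (j : nat) : a2 != b2 ->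
  (forall i, (i < j)%N -> e i = e' i) -> ~~ e j -> e' j ->
  Q_series (Peps a2 b2 e) <> Q_series (Peps a2 b2 e').
Proof.
move=> ab ee' ej e'j QE.
have card0 d : #|rank_elt (Peps a2 b2 d) 0| = 1%N by case: (Peps_differential1 d ab).
pose p d := rank_series (Peps a2 b2 d); pose N := (j + 5)%N.
have N0 : (0 < N)%N by rewrite /N; lia.
have pE i : (i < N)%N -> p e i = p e' i by exact: rank_series_agree.
have p0 d : p d 0%N = 1 by rewrite /p /rank_series card0.
have pN : p e N - p e' N = 1.
  rewrite /p /rank_series (card_rank_split a2 b2 ee' ej e'j).
  by rewrite -addn1 PoszD addrAC subrr add0r.
have FE i : (i < N)%N -> series_mul (p e) (p e) i = series_mul (p e') (p e') i.
  move=> iN; apply: eq_bigr => k _.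
  by rewrite !pE // (leq_ltn_trans _ iN) ?leq_subr // -ltnS.
have FN := series_mul_split pE pE N0; rewrite pN p0 in FN.
have MN := M2_series_split ab ee' ej e'j.
rewrite -!Q_seriesP // -QE in MN.
have /= := series_mul_split (fun i _ => erefl (Q_series (Peps a2 b2 e) i)) FE N0.
by rewrite /p in FN *; rewrite FN MN subrr mul0r addrAC subrr mulr1; lia.
Qed.

Lemma Q_series_inj (a2 b2 : rank2) : a2 != b2 ->
  injective (fun e : nat -> bool => Q_series (Peps a2 b2 e)).
Proof.
move=> ab e e' QE; apply: contrapT => /first_difference[j [ee' ej]].
case ejE : (e j) ej; case e'jE : (e' j) => // _.
  by apply: (@Q_series_split a2 b2 e' e j ab) (esym QE); rewrite ?e'jE // => i /ee'.
by apply: (@Q_series_split a2 b2 e e' j ab) QE; rewrite ?ejE.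
Qed.

(** * Cardinality of the set of quotients *)

Theorem corollary4p3 (R : realType) (a2 b2 : rank2) (hab : a2 != b2) :
  continuum_many R (quotient_set a2 b2) /\
  continuum_many R
    (quotient_set a2 b2 `&` [set S | nowhere_rational S])%classic.
Proof.
pose q (e : nat -> bool) := Q_series (Peps a2 b2 e).
have qI : injective q by exact: Q_series_inj.
split.
  apply: (@continuum_many_image R _ q) => //.
  by exists id => // e; exists e.
have cB : countable (q @^-1` [set S | ~ nowhere_rational S])%classic.
  have /countable_injP[f fI] := countable_rational.
  apply/countable_injP; exists (f \o q) => e e' /set_mem eB /set_mem e'B.
  by move=> /(fI _ _ (mem_set eB) (mem_set e'B)) /qI.
have [y yB] := interleave_avoids_countable cB.
apply: (@continuum_many_image R _ q); first by move=> S [].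
exists (fun x => interleave x y) => [x x' /qI/interleave_inj[]//|x].
by split; [exists (interleave x y) | exact: contrapT (yB x)].
Qed.
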